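(* Let $\mathcal{O}\subseteq\mathbb{N}$ be a set of non-negative integers which is closed under taking divisors and contains $0$. Then there exist a finitely generated torsion-free group $G$ and a finitely generated subgroup $H\leqslant G$ such that $\mathrm{Ord}_H(G)=\mathcal{O}$.
   Context: $\mathbb{N}$ contains $0$. Convention: no natural number divides $0$ (so ''closed under taking divisors'' imposes no condition coming from $0$). For a group $G$, a subset $S\subseteq G$ and $g\in G$, the (relative) order of $g$ in $S$ is $\mathrm{Ord}_S(g)=\min\{k\geq 1: g^k\in S\}$ if such $k$ exists, and $\mathrm{Ord}_S(g)=0$ otherwise. The spectrum of $G$ with respect to $S$ is $\mathrm{Ord}_S(G)=\{\mathrm{Ord}_S(g): g\in G\}$.
   Formalization: The set O is additionally assumed to contain 1; this excludes only O = {0}, for which the claim is false because the identity element always has relative order 1. *)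

(* Defs.v *)
From Stdlib Require List.
From mathcomp Require Import all_boot.
Set Implicit Arguments.
Unset Strict Implicit.
Unset Printing Implicit Defensive.

Section Groups.
Variables (T : Type) (mul : T -> T -> T) (one : T) (inv : T -> T).

Definition is_group : Prop :=
  [/\ forall x y z, mul x (mul y z) = mul (mul x y) z,
      forall x, mul one x = x,
      forall x, mul x one = x,
      forall x, mul (inv x) x = one
    & forall x, mul x (inv x) = one].

Fixpoint gpow (g : T) (n : nat) : T :=
  if n is n'.+1 then mul g (gpow g n') else one.

Inductive gen (S : seq T) : T -> Prop :=
  | gen_base x : List.In x S -> gen S x
  | gen_one : gen S one
  | gen_mul x y : gen S x -> gen S y -> gen S (mul x y)
  | gen_inv x : gen S x -> gen S (inv x).

Definition fin_gen_group : Prop := exists S : seq T, forall x, gen S x.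

Definition fin_gen_subgroup (H : T -> Prop) : Prop :=
  exists S : seq T, forall x, H x <-> gen S x.

Definition torsion_free : Prop :=
  forall (g : T) (n : nat), 0 < n -> gpow g n = one -> g = one.

Definition rel_order (S : T -> Prop) (g : T) (k : nat) : Prop :=
  (0 < k /\ S (gpow g k) /\ forall j, 0 < j -> j < k -> ~ S (gpow g j))
  \/ (k = 0 /\ forall j, 0 < j -> ~ S (gpow g j)).

Definition in_spectrum (S : T -> Prop) (n : nat) : Prop :=
  exists g : T, rel_order S g n.

End Groups.

(* O is closed under taking divisors, with the convention that no natural
   number divides 0 (so only nonzero elements impose a condition) *)
Definition divisor_closed (O : nat -> Prop) : Prop :=
  forall n d, 0 < n -> O n -> d %| n -> O d.

(* Main.v *)
Require Import Defs.
From Stdlib Require List.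
From Stdlib Require Import FunctionalExtensionality ProofIrrelevance.
From Stdlib Require Import ClassicalEpsilon.
From mathcomp Require Import all_boot all_order all_algebra.
From mathcomp Require Import zify ring.

(** Let [P] be the amalgam of infinite cyclic groups [<x_i>] obtained by
    identifying all the [x_i ^ nu i] with one central element [z].  By cyclic
    reduction of normal forms, an element of [P] with a nontrivial power in
    [<z>] is conjugate to a power of some [x_i]; so [P] is torsion-free, and its
    nonzero orders relative to [<z>] are divisors of the [nu i].

    In the unrestricted wreath product of a torsion-free group with Z, the copy
    of [P] at coordinate [0] keeps its relative orders, and no new nonzero order
    relative to the copy of [<z>] appears: [f ^ n] supported at [0] forces [f] to
    be supported at [0].  Applying the construction twice, a Neumann-Neumann
    argument with commutators gives three elements generating a subgroup that
    contains all the [x_i].  The subgroup [H] is the copy of [<z>]. *)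

Set Implicit Arguments.
Unset Strict Implicit.
Unset Printing Implicit Defensive.
Import Order.TTheory GRing.Theory Num.Theory.

(** * Groups, powers, subgroups and relative orders *)

Record group : Type := Group {
  carrier :> Type;
  op : carrier -> carrier -> carrier;
  one : carrier;
  inv : carrier -> carrier;
  groupP : is_group op one inv
}.
Arguments one {g} : simpl never.
Arguments carrier : simpl never.
Arguments op : simpl never.
Arguments inv : simpl never.

Declare Scope grp_scope.
Delimit Scope grp_scope with grp.
Local Notation "x * y" := (op x y) : grp_scope.
Local Notation "1" := one : grp_scope.
Local Notation "x ^-1" := (inv x) : grp_scope.
Local Notation "x ^+ n" := (gpow (@op _) one x n) : grp_scope.

Lemma left_inverse_is_group (T : Type) (mul : T -> T -> T) e (i : T -> T) :
  associative mul -> left_id e mul -> right_id e mul -> left_inverse e i mul ->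
  is_group mul e i.
Proof.
move=> mA m1 m1r mV; split=> // x; rewrite -(m1 (mul x (i x))) -(mV (i x)) -mA.
by rewrite (mA (i x)) mV m1.
Qed.

Section GroupTheory.
Variable G : group.
Implicit Types x y u : G.
Local Open Scope grp_scope.

Lemma opA x y z : x * (y * z) = x * y * z.
Proof. by case: (groupP G). Qed.
Lemma op1g x : 1 * x = x.
Proof. by case: (groupP G). Qed.
Lemma opg1 x : x * 1 = x.
Proof. by case: (groupP G). Qed.
Lemma opVg x : x^-1 * x = 1.
Proof. by case: (groupP G). Qed.
Lemma opgV x : x * x^-1 = 1.
Proof. by case: (groupP G). Qed.
Lemma opKg x y : x^-1 * (x * y) = y.
Proof. by rewrite opA opVg op1g. Qed.
Lemma opKVg x y : x * (x^-1 * y) = y.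
Proof. by rewrite opA opgV op1g. Qed.

Lemma inv_uniq x y : x * y = 1 -> y = x^-1.
Proof. by move=> h; rewrite -(opKg x y) h opg1. Qed.

Lemma inv_one : (1 : G)^-1 = 1.
Proof. by rewrite -(inv_uniq (op1g 1)). Qed.

Lemma gpowS x n : x ^+ n.+1 = x * x ^+ n.
Proof. by []. Qed.

Lemma gpow_add x m n : x ^+ (m + n) = x ^+ m * x ^+ n.
Proof. by elim: m => [|m IH] /=; rewrite ?op1g // IH opA. Qed.

Lemma gpow_mul x m n : x ^+ (m * n) = (x ^+ n) ^+ m.
Proof. by elim: m => [|m IH] //=; rewrite mulSn gpow_add IH. Qed.

Lemma gpow_conj x u n : (u^-1 * x * u) ^+ n = u^-1 * x ^+ n * u.
Proof.
elim: n => [|n IH] /=; first by rewrite opg1 opVg.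
by rewrite IH -!opA opKVg.
Qed.

Definition subgroup (H : G -> Prop) : Prop :=
  [/\ H 1, forall x y, H x -> H y -> H (x * y) & forall x, H x -> H x^-1].

Lemma subgroup_gen (S : seq G) : subgroup (gen (@op G) 1 (@inv G) S).
Proof. by split; [apply: gen_one | apply: gen_mul | apply: gen_inv]. Qed.

Lemma subgroup_gpow H x n : subgroup H -> H x -> H (x ^+ n).
Proof. by case=> h1 hM _ hx; elim: n => //= n IH; apply: hM. Qed.

Lemma gen_min H (S : seq G) x : subgroup H -> (forall y, List.In y S -> H y) ->
  gen (@op G) 1 (@inv G) S x -> H x.
Proof.
by case=> h1 hM hV hS; elim=> *; [apply: hS | | apply: hM | apply: hV].
Qed.

(** Division with remainder: [x ^+ (m %% n)] is a quotient of elements of [H], so minimality of [n]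
    forces the remainder to vanish. *)
Lemma rel_order_dvd H x n m : subgroup H -> 0 < n ->
  rel_order (@op G) 1 H x n -> H (x ^+ m) -> n %| m.
Proof.
move=> sH n0 [[_ [hn hmin]]|[n00]]; last by rewrite n00 in n0.
move=> hm; rewrite /dvdn; case: posnP => // r0.
case: (hmin (m %% n)); rewrite ?ltn_mod //.
have [_ hM hV] := sH.
have -> : x ^+ (m %% n) = (x ^+ (m %/ n * n))^-1 * x ^+ m.
  by rewrite {3}(divn_eq m n) gpow_add opKg.
by apply: hM => //; apply: hV; rewrite gpow_mul; apply: subgroup_gpow.
Qed.

End GroupTheory.

Local Notation generated S := (gen (@op _) one (@inv _) S) (only parsing).

(** Used to carry relative orders along embeddings and to replace a subset by an equivalent one. *)
Lemma rel_order_ext (G K : group) (A : G -> Prop) (B : K -> Prop) x y n :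
  (forall k, 0 < k -> A (x ^+ k)%grp <-> B (y ^+ k)%grp) ->
  rel_order (@op G) one A x n -> rel_order (@op K) one B y n.
Proof.
move=> e [[n0 [hn hm]]|[n0 hm]]; [left|right]; split=> //.
  by split=> [|j j0 jn /(e j j0)]; [apply/e | apply: hm].
by move=> j j0 /(e j j0); apply: hm.
Qed.

(** * Homomorphisms *)

Section Morphism.
Variables (G K : group) (f : G -> K).
Hypothesis fM : forall x y, f (x * y)%grp = (f x * f y)%grp.
Local Open Scope grp_scope.

Lemma morph1 : f 1 = 1.
Proof. by rewrite -(opKg (f 1) (f 1)) -fM op1g opVg. Qed.

Lemma morphV x : f x^-1 = (f x)^-1.
Proof. by apply: inv_uniq; rewrite -fM opgV morph1. Qed.

Lemma morph_gpow x n : f (x ^+ n) = f x ^+ n.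
Proof. by elim: n => [|n IH]; rewrite ?morph1 // !gpowS fM IH. Qed.

Lemma gen_map (S : seq G) y :
  generated (map f S) y <-> exists2 x, generated S x & y = f x.
Proof.
split; last first.
  case=> x hx ->; elim: hx => [z hz| |z t _ hz _ ht|z _ hz].
  - apply: gen_base; elim: S hz => //= a S IH [->|/IH]; by [left | right].
  - by rewrite morph1; apply: gen_one.
  - by rewrite fM; apply: gen_mul.
  - by rewrite morphV; apply: gen_inv.
elim=> [z hz| |z t _ [z' hz ->] _ [t' ht ->]|z _ [z' hz ->]].
- have [x hx ->] : exists2 x, List.In x S & z = f x.
    elim: S hz => //= a S IH [<-|/IH [x hx ->]]; first by exists a; [left|].
    by exists x; [right|].
  by exists x => //; apply: gen_base.
- by exists 1; [apply: gen_one | rewrite morph1].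
- by exists (z' * t'); [apply: gen_mul | rewrite fM].
- by exists z'^-1; [apply: gen_inv | rewrite morphV].
Qed.

End Morphism.

(** * Amalgams of cyclic groups over a common centre *)

Section Amalgam.
Variable nu : nat -> nat.
Hypothesis nu_gt0 : forall i, 0 < nu i.
Local Open Scope ring_scope.
Local Arguments modz : simpl never.
Local Arguments divz : simpl never.

(* A pair [([:: (i1, b1); ...; (ik, bk)], m)] stands for
   [x_i1 ^ b1 * ... * x_ik ^ bk * z ^ m]; it is a normal form when [0 < bj < nu ij]
   and consecutive indices differ. *)
Definition word : Type := seq (nat * int).

Definition headfree (i : nat) (w : word) : bool :=
  if w is s :: _ then s.1 != i else true.

Definition hd (i : nat) (w : word) : int :=
  if w is s :: _ then if s.1 == i then s.2 else 0 else 0.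

Definition tl (i : nat) (w : word) : word :=
  if w is s :: w' then if s.1 == i then w' else w else w.

Fixpoint reduced (w : word) : bool :=
  if w is s :: w' then
    [&& 0 < s.2, s.2 < (nu s.1)%:Z, headfree s.1 w' & reduced w']
  else true.

(* Left multiplication by [x_i ^ c] of a normal form not starting with [x_i]. *)
Definition push (i : nat) (c : int) (x : word * int) : word * int :=
  (if (c %% nu i)%Z == 0 then x.1 else (i, (c %% nu i)%Z) :: x.1,
   x.2 + (c %/ nu i)%Z).

(** Left multiplication by [x_i ^ a]: a leading syllable in factor [i] is merged with [a] before
    reduction modulo [nu i]. *)
Definition act (i : nat) (a : int) (x : word * int) : word * int :=
  push i (a + hd i x.1) (tl i x.1, x.2).

Definition shift (q : int) (x : word * int) : word * int := (x.1, x.2 + q).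

(** The syllables of [x] act one after the other on [y], so the result is reduced whenever [y]
    is. *)
Definition mulw (x y : word * int) : word * int :=
  foldr (fun s => act s.1 s.2) (shift x.2 y) x.1.

Definition onew : word * int := ([::], 0).

(** * Action of the cyclic factors on normal forms *)

Lemma nu_neq0 i : (nu i)%:Z != 0.
Proof. by have := nu_gt0 i; lia. Qed.

Lemma hd_headfree i w : headfree i w -> hd i w = 0.
Proof. by case: w => //= s w /negbTE ->. Qed.

Lemma tl_headfree i w : headfree i w -> tl i w = w.
Proof. by case: w => //= s w /negbTE ->. Qed.

Lemma headfree_tl i w : reduced w -> headfree i (tl i w).
Proof.
case: w => //= s w /and4P[_ _ hw _].
by case: (eqVneq s.1 i) => [<- //|/=].
Qed.

Lemma reduced_tl i w : reduced w -> reduced (tl i w).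
Proof.
by case: w => //= s w /and4P[h1 h2 h3 h4]; case: eqP => //= _; apply/and4P.
Qed.

Lemma reduced_push i c x :
  headfree i x.1 -> reduced x.1 -> reduced (push i c x).1.
Proof.
move=> hx rx; rewrite /push /=; case: eqP => //= /eqP c0.
rewrite hx rx !andbT lt0r c0 modz_ge0 ?nu_neq0 //=.
by apply: ltz_pmod; have := nu_gt0 i; lia.
Qed.

Lemma reduced_act i a x : reduced x.1 -> reduced (act i a x).1.
Proof.
by move=> rx; apply: reduced_push; [apply: headfree_tl | apply: reduced_tl].
Qed.

(** Multiples of [nu i] are carried into the exponent of [z], so reducing [c] before or after adding
    [a] gives the same result. *)
Lemma act_push i a c x : headfree i x.1 -> act i a (push i c x) = push i (a + c) x.
Proof.
move=> hx.
have {1}-> : push i c x = (if (c %% nu i)%Z == 0 then x.1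
   else (i, (c %% nu i)%Z) :: x.1, x.2 + (c %/ nu i)%Z) by [].
have -> : act i a (if (c %% nu i)%Z == 0 then x.1
   else (i, (c %% nu i)%Z) :: x.1, x.2 + (c %/ nu i)%Z)
  = push i (a + (c %% nu i)%Z) (x.1, x.2 + (c %/ nu i)%Z).
  rewrite /act /=; case: eqP => [->|_] /=; last by rewrite eqxx.
  by rewrite hd_headfree // tl_headfree.
rewrite /push /= modzDmr; congr (_, _).
have -> : a + c = (c %/ nu i)%Z * (nu i)%:Z + (a + (c %% nu i)%Z).
  by rewrite {1}(divz_eq c (nu i)); ring.
rewrite divzMDl ?nu_neq0 //; ring.
Qed.

Lemma push0 i x : push i 0 x = x.
Proof. by rewrite /push mod0z div0z addr0 eqxx -surjective_pairing. Qed.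

Lemma push_small i a x :
  0 < a -> a < (nu i)%:Z -> push i a x = ((i, a) :: x.1, x.2).
Proof.
move=> a0 an; rewrite /push modz_small ?divz_small ?addr0; try lia.
by rewrite gt_eqF.
Qed.

Lemma push_hd_tl i x : reduced x.1 -> push i (hd i x.1) (tl i x.1, x.2) = x.
Proof.
case: x => w m rw; rewrite /hd /tl /fst /snd.
case: w rw => [|[j b] w] /= rw; first exact: push0.
case/and4P: rw => h1 h2 _ _; case: eqP => [e|_]; last exact: push0.
by subst j; rewrite push_small.
Qed.

Lemma act0 i x : reduced x.1 -> act i 0 x = x.
Proof. by move=> rx; rewrite /act add0r push_hd_tl. Qed.

Lemma actD i a b x : reduced x.1 -> act i a (act i b x) = act i (a + b) x.
Proof.
by move=> rx; rewrite {2}/act act_push /= ?headfree_tl // /act addrA.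
Qed.

Lemma act_shift i a q x : act i a (shift q x) = shift q (act i a x).
Proof. by rewrite /act /push /shift /=; congr (_, _); ring. Qed.

(** This is the defining relation [x_i ^ nu i = z]. *)
Lemma actM_nu i q x : reduced x.1 -> act i (q * (nu i)%:Z) x = shift q x.
Proof.
move=> rx; rewrite -{2}(push_hd_tl i rx) /act /push /shift /=.
rewrite modzMDl divzMDl ?nu_neq0 //; congr (_, _); ring.
Qed.

Lemma shiftD p q x : shift p (shift q x) = shift (q + p) x.
Proof. by rewrite /shift /= addrA. Qed.

(** * Associativity and inverses *)

Lemma mulw_shiftl q x y : mulw (shift q x) y = shift q (mulw x y).
Proof.
case: x => w m; rewrite /mulw /=; elim: w => [|s w IH] /=.
  by rewrite !shiftD.
by rewrite IH act_shift.
Qed.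

Lemma reduced_mulw x y : reduced y.1 -> reduced (mulw x y).1.
Proof.
move=> ry; case: x => w m; rewrite /mulw /=.
by elim: w => [//|s w IH] /=; apply: reduced_act.
Qed.

Lemma mulw_cons s w m y : mulw (s :: w, m) y = act s.1 s.2 (mulw (w, m) y).
Proof. by []. Qed.

Lemma mulw_push i c x y :
  reduced y.1 -> mulw (push i c x) y = act i c (mulw x y).
Proof.
move=> ry; rewrite /push.
have r := reduced_mulw x ry.
rewrite [in RHS](divz_eq c (nu i)) [_ * _ + _]addrC -actD //.
rewrite actM_nu // -mulw_shiftl /shift.
by case: eqP => [->|_]; rewrite ?mulw_cons ?act0 //; apply: reduced_mulw.
Qed.

(** Equivariance of the product under each factor; associativity follows by induction on the
    syllables of the left argument. *)
Lemma mulw_act i a x y :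
  reduced x.1 -> reduced y.1 -> mulw (act i a x) y = act i a (mulw x y).
Proof.
move=> rx ry; rewrite /act mulw_push // -[in RHS](push_hd_tl i rx).
rewrite mulw_push // -/(act i a _) actD //; exact: reduced_mulw.
Qed.

Lemma mulwA x y z : reduced x.1 -> reduced y.1 -> reduced z.1 ->
  mulw x (mulw y z) = mulw (mulw x y) z.
Proof.
case: x => w m /= rx ry rz; elim: w rx => [_|s w IH /= /and4P[_ _ _ rw]].
  by rewrite -[LHS]/(shift m (mulw y z)) -mulw_shiftl.
by rewrite !mulw_cons IH // mulw_act //; apply: reduced_mulw.
Qed.

Lemma mul1w x : mulw onew x = x.
Proof. by rewrite /mulw /shift /= addr0 -surjective_pairing. Qed.

Lemma act_headfree i a x : 0 < a -> a < (nu i)%:Z -> headfree i x.1 ->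
  act i a x = ((i, a) :: x.1, x.2).
Proof.
by move=> a0 an hx; rewrite /act hd_headfree // tl_headfree // addr0 push_small.
Qed.

Lemma mulw_cat w m v n : reduced (w ++ v) -> mulw (w, m) (v, n) = (w ++ v, n + m).
Proof.
elim: w => [|s w IH] //= /and4P[h1 h2 h3 h4].
by rewrite mulw_cons IH // act_headfree //=; case: s {h1 h2 h3}.
Qed.

Lemma mulw1 x : reduced x.1 -> mulw x onew = x.
Proof. by case: x => w m rx; rewrite mulw_cat ?cats0 ?add0r. Qed.

(** Exponents in a normal form are positive, so an inverse syllable is built by [act], which carries
    the sign into the exponent of [z]. *)
Fixpoint invw (w : word) : word * int :=
  if w is s :: w' then mulw (invw w') (act s.1 (- s.2) onew) else onew.

Lemma reduced_invw w : reduced (invw w).1.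
Proof. by case: w => //= s w; apply: reduced_mulw; apply: reduced_act. Qed.

Lemma mulVw x : reduced x.1 -> mulw (shift (- x.2) (invw x.1)) x = onew.
Proof.
case: x => w m /=; rewrite mulw_shiftl.
elim: w => [_|s w IH /= /and4P[h1 h2 h3 h4]].
  by rewrite mul1w /shift /= subrr.
have -> : (s :: w, m) = act s.1 s.2 (w, m).
  by rewrite act_headfree //=; case: (s).
rewrite -mulwA ?reduced_act ?reduced_invw // mulw_act ?reduced_act //.
by rewrite mul1w actD // addNr act0 // IH.
Qed.

Lemma redP (x : {x : word * int | reduced x.1}) : reduced (val x).1.
Proof. exact: valP x. Qed.

Definition amalgam_op (x y : {x : word * int | reduced x.1}) :
    {x : word * int | reduced x.1} :=
  exist _ (mulw (val x) (val y)) (reduced_mulw (val x) (redP y)).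

Definition amalgam_one : {x : word * int | reduced x.1} :=
  exist (fun x : word * int => is_true (reduced x.1)) onew isT.

Definition amalgam_inv (x : {x : word * int | reduced x.1}) :
    {x : word * int | reduced x.1} :=
  exist (fun x : word * int => is_true (reduced x.1))
    (shift (- (val x).2) (invw (val x).1)) (reduced_invw (val x).1).

Lemma amalgam_is_group : is_group amalgam_op amalgam_one amalgam_inv.
Proof.
apply: left_inverse_is_group => [x y z|x|x|x]; apply: val_inj => /=.
- by apply: mulwA; apply: redP.
- exact: mul1w.
- by apply: mulw1; apply: redP.
- by apply: mulVw; apply: redP.
Qed.

Definition amalgam : group := Group amalgam_is_group.

(** * The roots [x_i] and the central subgroup *)

Local Open Scope grp_scope.
Implicit Types x y u : amalgam.

Definition root (i : nat) (c : int) : amalgam :=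
  exist (fun x : word * int => is_true (reduced x.1))
    (act i c onew) (reduced_act i c (isT : reduced onew.1)).

Definition centre (c : int) : amalgam :=
  exist (fun x : word * int => is_true (reduced x.1)) ([::], c) isT.

Definition in_centre x : Prop := (val x).1 = [::].

Lemma val_root_op i c x : val (root i c * x) = act i c (val x).
Proof. by rewrite [LHS]mulw_act ?mul1w //; apply: redP. Qed.

Lemma rootD i a b : root i a * root i b = root i (a + b)%R.
Proof. by apply: val_inj; rewrite val_root_op [LHS]actD. Qed.

Lemma root0 i : root i 0 = 1.
Proof. by apply: val_inj; apply: act0. Qed.

Lemma root_gpow i c n : root i c ^+ n = root i (c * n%:Z)%R.
Proof.
elim: n => [|n IH]; first by rewrite mulr0 root0.
by rewrite gpowS IH rootD intS mulrDr mulr1.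
Qed.

Lemma root_nu i c : root i (c * (nu i)%:Z)%R = centre c.
Proof. by apply: val_inj; rewrite [LHS]actM_nu // /shift add0r. Qed.

Lemma in_centreP x : in_centre x -> x = centre (val x).2.
Proof.
by move=> hx; apply: val_inj; rewrite [LHS]surjective_pairing hx.
Qed.

Lemma mulw_shiftr q (x y : word * int) : mulw x (shift q y) = shift q (mulw x y).
Proof.
case: x => w m; rewrite /mulw /=; elim: w => [|s w IH] /=.
  by rewrite !shiftD addrC.
by rewrite IH act_shift.
Qed.

Lemma centreC c x : centre c * x = x * centre c.
Proof.
apply: val_inj; have -> : val (centre c * x) = shift c (val x) by [].
rewrite -[RHS]/(mulw (val x) ([::], c)).
have -> : ([::] : word, c) = shift c onew by rewrite /shift add0r.
by rewrite mulw_shiftr mulw1 //; apply: redP.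
Qed.

Lemma centre_conj c u : u^-1 * centre c * u = centre c.
Proof. by rewrite -opA centreC opKg. Qed.

Lemma subgroup_in_centre : subgroup in_centre.
Proof.
by split=> // [x y /in_centreP -> /in_centreP ->|x /in_centreP ->].
Qed.

(** * Cyclic reduction *)

Lemma mulw_rcons w s m (y : word * int) :
  mulw (rcons w s, m) y = mulw (w, m) (act s.1 s.2 y).
Proof. by rewrite /mulw /= foldr_rcons act_shift. Qed.

Lemma size_act i a (x : word * int) : (size (act i a x).1 <= (size x.1).+1)%N.
Proof.
rewrite /act /push /=.
have h : (size (tl i x.1) <= size x.1)%N.
  by case: x => -[|s w] m //=; case: ifP => //= _; apply: leqnSn.
by case: ifP => _ //=; apply: leq_trans h _.
Qed.

Lemma size_mulw (x y : word * int) : (size (mulw x y).1 <= size x.1 + size y.1)%N.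
Proof.
case: x => w m; rewrite /mulw /=; elim: w => [|s w IH] //=.
by rewrite addSn; apply: leq_trans (size_act _ _ _) _.
Qed.

Lemma reduced_cat s w v :
  reduced (s :: w) -> headfree (last s w).1 v -> reduced v ->
  reduced ((s :: w) ++ v).
Proof.
elim: w s => [|t w IH] s rs hv rv; case/and4P: rs => h1 h2 h3 h4.
  by apply/and4P; split.
by apply/and4P; split => //; apply: IH.
Qed.

(** Nothing merges where consecutive copies of the word meet, so the word of [x ^+ k] is that of [x]
    repeated [k] times. *)
Lemma cyclically_reduced_gpow x s w : (val x).1 = s :: w ->
  s.1 != (last s w).1 -> forall k, (0 < k)%N -> ~ in_centre (x ^+ k).
Proof.
move=> ex hs.
have hr : reduced (s :: w) by rewrite -ex; apply: redP.
(* The first conjunct lets another copy of the word be prepended without reduction. *)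
have main k : headfree (last s w).1 (val (x ^+ k)).1 /\
    ((0 < k)%N -> (val (x ^+ k)).1 <> [::]).
  elim: k => [|k [IH _]] //.
  suff -> : (val (x ^+ k.+1)).1 = (s :: w) ++ (val (x ^+ k)).1 by [].
  rewrite -[val _]/(mulw (val x) (val (x ^+ k))).
  rewrite [val x]surjective_pairing ex [val (x ^+ k)]surjective_pairing.
  by rewrite mulw_cat //; apply: reduced_cat => //; apply: redP.
by move=> k k0; case: (main k) => _; apply.
Qed.

(* Cyclic reduction: conjugating by the first syllable shortens a normal form
   whose first and last syllables lie in the same factor. *)
Lemma conj_root_or_free x :
  (forall k, (0 < k)%N -> ~ in_centre (x ^+ k)) \/
  exists i c u, x = u^-1 * root i c * u.
Proof.
have [n] := ubnP (size (val x).1); elim: n x => // n IH x.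
have hr := redP x; case ex: (val x) => [w m] /=; rewrite ex /= in hr.
case: w => [|s w] in ex hr *.
  (* A central element is a power of any root; [x_0] is chosen. *)
  move=> _; right; exists 0%N, (m * (nu 0)%:Z)%R, (one : amalgam).
  by rewrite root_nu inv_one op1g opg1; apply: val_inj; rewrite ex.
case/lastP: w => [|w t] in ex hr *.
  move=> _; right; exists s.1, (m * (nu s.1)%:Z + s.2)%R, (one : amalgam).
  rewrite inv_one op1g opg1 -rootD root_nu; apply: val_inj.
  rewrite ex /=; case/and4P: hr => h1 h2 _ _.
  by rewrite act_headfree // /mulw /shift /= add0r; case: (s).
have [est|nst] := eqVneq s.1 t.1; last first.
  by move=> _; left; apply: cyclically_reduced_gpow (_ : _ = s :: rcons w t) _;
    rewrite ?ex ?last_rcons.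
move=> hsz.
set u := root s.1 s.2; set y := u^-1 * x * u.
have exy : x = u * y * u^-1 by rewrite /y -!opA opKVg opgV opg1.
have sz : (size (val y).1 < n)%N.
  have hr' : reduced (rcons w t, m).1 by case/and4P: hr.
  pose x' : amalgam :=
    exist (fun x : word * int => is_true (reduced x.1)) (rcons w t, m) hr'.
  have ex' : x = u * x'.
    apply: val_inj; rewrite val_root_op ex /=.
    by case/and4P: hr => h1 h2 h3 _; rewrite act_headfree //; case: (s).
  rewrite /y ex' opKg.
  (* The first syllable moves to the end and merges with [t], which lies in the same factor, so at
     least one syllable is lost. *)
  have -> : val (x' * u) = mulw (w, m) (act t.1 (t.2 + s.2) onew).
    by rewrite -[LHS]/(mulw (rcons w t, m) (act s.1 s.2 onew)) mulw_rcons est actD.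
  apply: leq_ltn_trans (size_mulw _ _) _ => /=.
  have := size_act t.1 (t.2 + s.2) onew.
  by move: hsz; rewrite /= size_rcons; lia.
case: (IH y sz) => [hy|[i [c [v ey]]]]; [left|right].
  (* Conjugation fixes central elements, so a central power of [x] would be one of [y]. *)
  move=> k k0 /in_centreP hk; apply: (hy k k0).
  by rewrite /y gpow_conj hk centre_conj.
exists i, c, (v * u^-1); rewrite exy ey.
suff -> : (v * u^-1)^-1 = u * v^-1 by rewrite !opA.
by symmetry; apply: inv_uniq; rewrite -!opA opKg opgV.
Qed.

(** A torsion element has a central power, hence is conjugate to some [x_i ^ c]. If
    [x_i ^ (c * n) = 1], both remainder and quotient of [c * n] by [nu i] vanish, so [c = 0]. *)
Lemma torsion_free_amalgam : torsion_free (@op amalgam) 1.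
Proof.
move=> x n n0 xn; case: (conj_root_or_free x) => [h|[i [c [u ex]]]].
  by case: (h n n0); rewrite xn.
have e1 : u^-1 * (root i c ^+ n) * u = 1 by rewrite -gpow_conj -ex.
have e2 : root i (c * n%:Z)%R = 1.
  have : u * (u^-1 * (root i c ^+ n) * u) * u^-1 = 1 by rewrite e1 opg1 opgV.
  by rewrite -!opA opKVg opgV opg1 root_gpow.
suff c0 : c = 0 by rewrite ex c0 root0 opg1 opVg.
have /(congr1 val) /= := e2.
rewrite /act /push /= addr0 add0r; case: eqP => // /eqP d [q].
have : (c * n%:Z)%R = 0%R by rewrite (divz_eq (c * n%:Z) (nu i)) q (eqP d).
by move/eqP; rewrite mulf_eq0 => /orP[/eqP //|]; lia.
Qed.

(** Such an [x] is conjugate to some [x_i ^ c], and its [nu i]-th power is [z ^ c]. *)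
Lemma rel_order_amalgam x n : (0 < n)%N ->
  rel_order (@op amalgam) 1 in_centre x n -> exists i, (n %| nu i)%N.
Proof.
move=> n0 hn; case: (conj_root_or_free x) => [h|[i [c [u ex]]]].
  case: hn => [[_ [hn _]]|[e _]]; last by rewrite e in n0.
  by case: (h n n0).
exists i; apply: (rel_order_dvd subgroup_in_centre n0 hn).
by rewrite ex gpow_conj root_gpow root_nu centre_conj.
Qed.

Lemma rel_order_root i : rel_order (@op amalgam) 1 in_centre (root i 1) (nu i).
Proof.
left; split; first exact: nu_gt0.
split=> [|j j0 jn]; first by rewrite root_gpow root_nu.
rewrite root_gpow mul1r /in_centre.
have -> : val (root i j%:Z) = act i j%:Z onew by [].
by rewrite act_headfree //; lia.
Qed.

Lemma in_centre_gen x : in_centre x <->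
  gen (@op amalgam) 1 (@inv amalgam) [:: centre 1] x.
Proof.
split; last first.
  by apply: gen_min subgroup_in_centre _ => y /= [<-|].
have pos k : gen (@op amalgam) 1 (@inv amalgam) [:: centre 1] (centre k%:Z).
  (* Powers of [z] are computed inside the cyclic group of [x_0], as [z = x_0 ^ nu 0]. *)
  have -> : centre k%:Z = centre 1 ^+ k.
    by rewrite -(root_nu 0 1) root_gpow mulrAC root_nu mul1r.
  by apply: subgroup_gpow; [apply: subgroup_gen | apply: gen_base; left].
move/in_centreP => ->; case: (val x).2 => k; first exact: pos.
have -> : centre (Negz k) = (centre k.+1%:Z)^-1.
  by apply: inv_uniq; apply: val_inj; rewrite /= /mulw /shift /= NegzE addNr.
exact/gen_inv/pos.
Qed.

End Amalgam.

(** * Unrestricted wreath products with Z *)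

Section Wreath.
Variable P : group.
Local Open Scope ring_scope.
Local Open Scope grp_scope.

(** Semidirect product of all functions from Z to [P] with Z acting by shifts. Infinite supports are
    allowed so that step functions belong to the group. *)
Definition wreath_op (x y : (int -> P) * int) : (int -> P) * int :=
  (fun i => x.1 i * y.1 (i + x.2)%R, (x.2 + y.2)%R).

Definition wreath_inv (x : (int -> P) * int) : (int -> P) * int :=
  (fun i => (x.1 (i - x.2)%R)^-1, (- x.2)%R).

Lemma wreath_is_group : is_group wreath_op (fun=> 1, 0%R) wreath_inv.
Proof.
apply: left_inverse_is_group => [x y z|x|x|x]; rewrite /wreath_op /=.
- rewrite addrA; congr pair.
  by apply: functional_extensionality => i; rewrite opA addrA.
- rewrite [RHS]surjective_pairing add0r; congr pair.
  by apply: functional_extensionality => i; rewrite op1g addr0.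
- rewrite [RHS]surjective_pairing addr0; congr pair.
  by apply: functional_extensionality => i; rewrite opg1.
- rewrite addNr; congr pair.
  by apply: functional_extensionality => i; rewrite opVg.
Qed.

Definition wreath : group := Group wreath_is_group.
Implicit Types x y : wreath.

Lemma wreath_ext x y : x.1 =1 y.1 -> x.2 = y.2 -> x = y.
Proof.
by case: x y => [f s] [g t] /= /functional_extensionality -> ->.
Qed.

Lemma wreathM1 x y i : (x * y).1 i = x.1 i * y.1 (i + x.2)%R.
Proof. by []. Qed.

Lemma wreathM2 x y : (x * y).2 = (x.2 + y.2)%R.
Proof. by []. Qed.

Lemma wreathV1 x i : (x^-1).1 i = (x.1 (i - x.2)%R)^-1.
Proof. by []. Qed.

Lemma wreathV2 x : (x^-1).2 = (- x.2)%R.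
Proof. by []. Qed.

Definition wreathE := (wreathM1, wreathM2, wreathV1, wreathV2).

Definition delta (p : P) : wreath := (fun i => if i == 0%R then p else 1, 0%R).

Definition translation : wreath := (fun=> 1, 1%R).

Definition base (f : int -> P) : wreath := (f, 0%R).

Lemma deltaM p q : delta (p * q) = delta p * delta q.
Proof.
apply: wreath_ext => // i; rewrite !wreathE /= addr0.
by case: eqP => _; rewrite ?op1g.
Qed.

Lemma gpow_snd x n : (x ^+ n).2 = (x.2 * n%:Z)%R.
Proof.
by elim: n => [|n IH]; rewrite ?mulr0 // gpowS wreathM2 IH intS mulrDr mulr1.
Qed.

Lemma gpow_fst x n i : x.2 = 0%R -> (x ^+ n).1 i = x.1 i ^+ n.
Proof.
by move=> x0; elim: n => [|n IH] //; rewrite !gpowS wreathM1 x0 addr0 IH.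
Qed.

Lemma gpow_snd_eq0 x n : (0 < n)%N -> (x ^+ n).2 = 0%R -> x.2 = 0%R.
Proof. by rewrite gpow_snd => n0 /eqP; rewrite mulf_eq0 => /orP[/eqP|] //; lia. Qed.

Lemma torsion_free_wreath :
  torsion_free (@op P) 1 -> torsion_free (@op wreath) 1.
Proof.
move=> tf x n n0 xn.
have x0 : x.2 = 0%R by apply: gpow_snd_eq0 n0 _; rewrite xn.
apply: wreath_ext => // i; apply: (tf _ n n0).
by rewrite -gpow_fst // xn.
Qed.

Definition delta_image (H : P -> Prop) x : Prop := exists2 p, H p & x = delta p.

Lemma delta_inj p q : delta p = delta q -> p = q.
Proof. by move/(congr1 (fun x : wreath => x.1 0%R)). Qed.

Lemma delta_imageP H p : delta_image H (delta p) <-> H p.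
Proof. by split=> [[q hq /delta_inj ->]|hp] //; exists p. Qed.

Lemma rel_order_delta H p n :
  rel_order (@op P) 1 H p n <->
  rel_order (@op wreath) 1 (delta_image H) (delta p) n.
Proof.
by split; apply: rel_order_ext => k _;
  rewrite -(morph_gpow deltaM) delta_imageP.
Qed.

(* As [P] is torsion-free, a power of [x] supported at [0] forces [x] itself
   to be supported at [0]. *)
Lemma rel_order_wreath H x n : torsion_free (@op P) 1 -> (0 < n)%N ->
  rel_order (@op wreath) 1 (delta_image H) x n ->
  exists p, rel_order (@op P) 1 H p n.
Proof.
move=> tf n0 hx; suff ex : x = delta (x.1 0%R).
  by exists (x.1 0%R); apply/rel_order_delta; rewrite -ex.
case: hx => [[_ [[p _ xn] _]]|[e _]]; last by rewrite e in n0.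
have x0 : x.2 = 0%R by apply: gpow_snd_eq0 n0 _; rewrite xn.
apply: wreath_ext => // i /=; case: eqP => [-> //|/eqP i0].
by apply: (tf _ n n0); rewrite -gpow_fst // xn /= (negbTE i0).
Qed.

Lemma rel_order_translation H :
  rel_order (@op wreath) 1 (delta_image H) translation 0.
Proof.
right; split=> // j j0 [p _] /(congr1 (fun x : wreath => x.2)).
by rewrite gpow_snd /=; lia.
Qed.

Lemma translation_gpow n : translation ^+ n = (fun=> 1, n%:Z).
Proof.
elim: n => [|n IH] //; rewrite gpowS IH.
by apply: wreath_ext => [i|]; rewrite !wreathE /= ?op1g.
Qed.

Lemma translation_conj n f :
  translation ^+ n * base f * (translation ^+ n)^-1 = base (fun i => f (i + n%:Z)%R).
Proof.
rewrite translation_gpow; apply: wreath_ext => [i|]; rewrite !wreathE /=.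
  by rewrite inv_one opg1 op1g.
by rewrite addr0 subrr.
Qed.

(** * Commutators that isolate one coordinate *)

Definition commutator (G : group) (x y : G) : G := x * y * (x^-1 * y^-1).

(** Translation moves the step by one place, so the step and its translate differ only at coordinate
    0. *)
Lemma commutator_step p :
  commutator translation (base (fun i => if (0 < i)%R then p else 1)) = delta p.
Proof.
apply: wreath_ext => [i|]; rewrite !wreathE //=.
rewrite inv_one !op1g addr0 addrK.
have [->|i0] := eqVneq i 0%R; first by rewrite /= inv_one opg1.
have -> : (0 < i + 1)%R = (0 < i)%R by lia.
by case: ifP; rewrite opgV.
Qed.

Lemma commutator_delta p f :
  commutator (delta p) (base f) = delta (commutator p (f 0%R)).
Proof.
apply: wreath_ext => [i|] //; rewrite !wreathE /= !(addr0, oppr0).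
case: eqP => [->|_] //.
by rewrite inv_one !op1g opgV.
Qed.

End Wreath.

(* The generators of a finitely generated subgroup of a double wreath product
   that contains a copy of every [p n]: conjugating [spread p] by a power of the
   outer translation puts the step function of value [p n] at [0], and the
   commutator with [delta (translation P)] isolates first the outer, then the
   inner coordinate [0]. *)
Section DoubleWreath.
Variables (P : group) (p : nat -> P).
Local Open Scope grp_scope.

Definition spread : wreath (wreath P) :=
  base (fun j => base (fun i => if (0 < i)%R then p `|j|%N else 1)).

Definition wreath_gens : seq (wreath (wreath P)) :=
  [:: delta (translation P); spread; translation (wreath P)].

Lemma gen_delta_delta n :
  generated wreath_gens (delta (delta (p n))).
Proof.
have hphi : generated wreath_gens (delta (translation P)).
  by apply: gen_base; left.
have hpsi : generated wreath_gens spread by apply: gen_base; right; left.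
have hs : generated wreath_gens (translation (wreath P) ^+ n).
  apply: subgroup_gpow; first exact: subgroup_gen.
  by apply: gen_base; right; right; left.
set c := translation (wreath P) ^+ n * spread * (translation (wreath P) ^+ n)^-1.
have hc : generated wreath_gens c.
  by apply: gen_mul; [apply: gen_mul | apply: gen_inv].
have -> : delta (delta (p n)) = commutator (delta (translation P)) c.
  by rewrite /c translation_conj commutator_delta add0r commutator_step.
by apply: gen_mul; apply: gen_mul => //; apply: gen_inv.
Qed.

End DoubleWreath.

(** * Finitely generated subgroups as groups *)

Section Subgroup.
Variables (M : group) (S : seq M).
Local Open Scope grp_scope.

Let T := {x : M | generated S x}.

Let sval_inj : injective (fun x : T => sval x).
Proof.
move=> [x hx] [y hy] /= e; subst y.
by rewrite (proof_irrelevance _ hx hy).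
Qed.

Definition gen_op (x y : T) : T := exist _ _ (gen_mul (svalP x) (svalP y)).
Definition gen_unit : T := exist _ _ (gen_one (@op M) 1 (@inv M) S).
Definition gen_opp (x : T) : T := exist _ _ (gen_inv (svalP x)).

Lemma gen_is_group : is_group gen_op gen_unit gen_opp.
Proof.
apply: left_inverse_is_group => [x y z|x|x|x]; apply: sval_inj => /=.
- exact: opA.
- exact: op1g.
- exact: opg1.
- exact: opVg.
Qed.

Definition gen_group : group := Group gen_is_group.

Let incl (x : gen_group) : M := sval x.

Let inclM x y : incl (x * y) = incl x * incl y. Proof. by []. Qed.

Lemma seq_lift (R : seq M) : (forall x, List.In x R -> generated S x) ->
  exists R' : seq gen_group, map incl R' = R.
Proof.
elim: R => [|x R IH] h; first by exists [::].
have [|R' <-] := IH; first by move=> y hy; apply: h; right.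
have hx : generated S x by apply: h; left.
by exists (exist _ x hx :: R').
Qed.

Lemma fin_gen_subgroup_incl (R : seq M) :
  (forall x, List.In x R -> generated S x) ->
  fin_gen_subgroup (@op gen_group) 1 (@inv gen_group)
    (fun x => generated R (incl x)).
Proof.
move=> /seq_lift [R' <-]; exists R' => x; split=> [/(gen_map inclM)|hx].
  by case=> y hy /sval_inj ->.
by apply/(gen_map inclM); exists x.
Qed.

Lemma fin_gen_gen_group : fin_gen_group (@op gen_group) 1 (@inv gen_group).
Proof.
have [S' hS] := fin_gen_subgroup_incl (fun x => @gen_base _ _ _ _ S x).
by exists S' => x; apply/hS; apply: svalP.
Qed.

Lemma torsion_free_gen_group :
  torsion_free (@op M) 1 -> torsion_free (@op gen_group) 1.
Proof.
move=> tf x n n0 xn; apply: sval_inj; apply: (tf _ n n0).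
by rewrite -[gpow _ _ _ _](morph_gpow inclM) xn.
Qed.

(** Relative orders may be computed in the ambient group; the subgroup only restricts which elements
    count. *)
Lemma in_spectrum_gen_group (H : M -> Prop) n :
  in_spectrum (@op gen_group) 1 (fun x => H (incl x)) n <->
  exists2 x, generated S x & rel_order (@op M) 1 H x n.
Proof.
split=> [[x hx]|[x gx hx]].
  exists (incl x); first exact: svalP.
  by apply: rel_order_ext hx => k _; rewrite (morph_gpow inclM).
exists (exist _ x gx); apply: rel_order_ext hx => k _.
by rewrite (morph_gpow inclM).
Qed.

End Subgroup.

(** The identity has relative order 1, so 1 lies in every spectrum; given the other two hypotheses,
    [O 1] excludes only the set {0}. *)
Theorem theorem4p3 (O : nat -> Prop) :
  divisor_closed O -> O 0 -> O 1 ->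
  exists (T : Type) (mul : T -> T -> T) (one : T) (inv : T -> T)
         (H : T -> Prop),
    [/\ is_group mul one inv,
        fin_gen_group mul one inv,
        torsion_free mul one,
        fin_gen_subgroup mul one inv H
      & forall n, O n <-> in_spectrum mul one H n].
Proof.
move=> Odiv O0 O1.
(* Each positive element of [O] is the value of [nu] at itself; the default 1 keeps every value
   positive and in [O]. *)
pose nu i := if excluded_middle_informative (0 < i /\ O i) then i else 1.
have nuP i : 0 < nu i /\ O (nu i).
  by rewrite /nu; case: excluded_middle_informative.
have nuE i : 0 < i -> O i -> nu i = i.
  by move=> i0 Oi; rewrite /nu; case: excluded_middle_informative => // -[].
have nu_gt0 i : 0 < nu i by case: (nuP i).
pose P := amalgam nu_gt0; pose p i : P := root nu_gt0 i 1%R.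
have tf : torsion_free (@op P) one by apply: torsion_free_amalgam.
pose S := wreath_gens p; pose R := [:: delta (delta (centre nu_gt0 1%R))].
have RE x : generated R x <-> delta_image (delta_image (@in_centre _ nu_gt0)) x.
  rewrite -[R]/(map (@delta _) (map (@delta _) [:: centre nu_gt0 1%R])).
  rewrite (gen_map (@deltaM _)); split=> -[y].
    case/(gen_map (@deltaM _)) => z hz -> ->.
    by exists (delta z) => //; exists z => //; apply/in_centre_gen.
  case=> z hz -> ->; exists (delta z) => //.
  by apply/(gen_map (@deltaM _)); exists z => //; apply/in_centre_gen.
have hR x : List.In x R -> generated S x.
  (* Since [nu 1 = 1], the generator [z] is the root [x_1], whose copy is already known to lie in
     the subgroup. *)
  case=> // <-; have -> : centre nu_gt0 1%R = p 1.
    by rewrite -(root_nu nu_gt0 1) mul1r nuE.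
  exact: gen_delta_delta.
exists (gen_group S), (@op _), one, (@inv _), (fun x => generated R (sval x)).
split.
- exact: gen_is_group.
- exact: fin_gen_gen_group.
- by apply: torsion_free_gen_group; do 2!apply: torsion_free_wreath.
- exact: fin_gen_subgroup_incl.
move=> n; rewrite in_spectrum_gen_group; split=> [On|[x _ hx]].
  have [->|n0] := posnP n.
    (* No positive power of the outer translation lies in the base group, which gives order 0. *)
    exists (translation (wreath P)); first by apply: gen_base; right; right; left.
    by apply: rel_order_ext (rel_order_translation _) => k _; symmetry; apply: RE.
  exists (delta (delta (p n))); first exact: gen_delta_delta.
  (* The root [x_n] has order [nu n = n], kept by both embeddings. *)
  have /rel_order_delta/rel_order_delta := rel_order_root nu_gt0 n.
  by rewrite nuE //; apply: rel_order_ext => k _; symmetry; apply: RE.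
have [->//|n0] := posnP n.
have {}hx : rel_order (@op _) one
    (delta_image (delta_image (@in_centre _ nu_gt0))) x n.
  by apply: rel_order_ext hx => k _; apply: RE.
(* A positive order descends through both wreath products to the amalgam, where it divides some
   [nu i] in [O]. *)
have [y hy] := rel_order_wreath (torsion_free_wreath tf) n0 hx.
have [z /(rel_order_amalgam n0) [i hi]] := rel_order_wreath tf n0 hy.
by case: (nuP i) => nu0 Onu; apply: Odiv hi.
Qed.
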